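(* Let $Q$ be a quadrangulation with $n$ vertices and a strong labeling, and number its vertices $v_1,\dots,v_n$ so that $f_1(v_1)<f_1(v_2)<\dots<f_1(v_n)$ (these values are pairwise distinct). Place the vertices in this order on a line, and draw the edges of $T_0$ as arcs on one side of the line and the edges of $T_1$ as arcs on the other side. Then, for each $\ell\in\{0,1\}$, the tree $T_\ell$ is non-crossing, i.e. there are no two edges $v_av_c$ and $v_bv_d$ of $T_\ell$ with $a<b<c<d$, and alternating, i.e. there are no two edges $v_iv_j$ and $v_jv_k$ of $T_\ell$ with $i<j<k$. In particular this gives a $2$-book embedding of $Q$ with one tree on each page.
   Context: A quadrangulation is a simple plane graph with at least four vertices all of whose faces (including the outer face) are bounded by $4$-cycles; it is bipartite, with vertices properly colored black and white; it has $n-3$ bounded faces. An angle is an incidence of a vertex with a face. A strong labeling of $Q$ is a map from the angles of $Q$ to $\{0,1\}$ such that: (G0) the two black vertices on the outer face are named $s_0$ and $s_1$, and all angles at $s_i$ are labeled $i$; (G1) for each vertex $v\notin\{s_0,s_1\}$ the labels around $v$ form one non-empty cyclic interval of $1$s and one non-empty cyclic interval of $0$s; (G2) for each edge, the two labels on the two sides of the edge coincide at one endpoint and differ at the other; (G3) the labels in each bounded face, read cyclically, are $0,0,1,1$, and reading the labels of the outer face in clockwise order starting at $s_0$ they are $0,0,1,1$. Each edge is colored with the common label at the endpoint where its two labels coincide and oriented towards that endpoint; $T_i$ is the set of edges of color $i$; each $T_i$ is a directed tree with sink $s_i$ spanning all vertices but $s_{1-i}$, and $T_0\cup T_1$ is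 the whole edge set. For a non-special vertex $v$, $P_i(v)$ is the directed path in $T_i$ from $v$ to $s_i$; $P_0(v)$ and $P_1(v)$ share only $v$ and split the quadrangulation into two regions, $R_i(v)$ being the region to the right of $P_i(v)$, including both paths. For non-special $v$, $f_i(v)$ is the number of bounded faces contained in $R_i(v)$; for the special vertices $f_0(s_0)=f_1(s_1)=-1$ and $f_1(s_0)=f_0(s_1)=n-2$. One has $f_0(v)+f_1(v)=n-3$ for every vertex. *)

(* Defs.v *)
(* Plane maps are encoded as combinatorial maps (rotation systems). *)
From HB Require Import structures.
From mathcomp Require Import all_boot all_order all_fingroup all_algebra.

Set Implicit Arguments.
Unset Strict Implicit.
Unset Printing Implicit Defensive.

Import GRing.Theory Num.Theory.
Local Open Scope ring_scope.

(* CONVENTIONS.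
   D : darts (half-edges), V : vertices.
   alpha : the edge involution (x and alpha x are the two darts of one edge),
   sigma : the counterclockwise rotation of darts around their tail vertex,
   vert x : the tail vertex of the dart x (so vert (alpha x) is its head).
   phi x := sigma (alpha x) is the face permutation; the phi-orbit of x is the
   face lying to the RIGHT of x.  Bounded faces are thus traversed clockwise by
   phi and the outer face counterclockwise.
   The angle (corner) at vert x between x and sigma x is identified with x; it
   lies in the face of alpha x (face to the left of x).  A labeling of angles is
   thus a map lab : D -> bool (false = 0, true = 1). *)

Section QMap.
Variables (D V : finType) (alpha sigma : {perm D}) (vert : D -> V).

Definition phi : {perm D} := (alpha * sigma)%g.

Definition face_of (x : D) : {set D} := [set y | fconnect phi x y].

Definition nfaces : nat := #|[set face_of x | x : D]|.

Definition map_rel : rel D := fun a b => (b == alpha a) || (b == sigma a).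

(* a connected map of genus 0 (Euler's formula), i.e. a connected plane graph *)
Definition plane_map : Prop :=
  [/\ (forall x, alpha x != x) /\ (forall x, alpha (alpha x) = x),
      forall x y, (vert x == vert y) = fconnect sigma x y,
      forall v, exists x, vert x = v,
      forall x y, connect map_rel x y &
      (#|V| + nfaces = #|D| %/ 2 + 2)%N ].

Definition simple_map : Prop :=
  (forall x, vert (alpha x) != vert x) /\
  (forall x y, vert x = vert y -> vert (alpha x) = vert (alpha y) -> x = y).

Definition face_is_4cycle (x : D) : Prop :=
  iter 4 phi x = x /\ uniq [seq vert (iter k phi x) | k <- iota 0 4].

Definition quadrangulation (black : V -> bool) : Prop :=
  [/\ plane_map, simple_map, (forall x, face_is_4cycle x), (4 <= #|V|)%N &
      (forall x, black (vert x) != black (vert (alpha x)))].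

Variables (black : V -> bool) (outer : D) (s0 s1 : V) (lab : D -> bool).

Definition bounded (x : D) : bool := ~~ fconnect phi outer x.

Definition strong_labeling : Prop :=
  [/\
      [/\ s0 != s1, black s0 && black s1,
          [exists x in face_of outer, vert x == s0],
          [exists x in face_of outer, vert x == s1] &
          forall x, (vert x = s0 -> lab x = false) /\ (vert x = s1 -> lab x = true)],
      (forall v, v != s0 -> v != s1 ->
         exists x k, [/\ vert x = v, (0 < k < fingraph.order sigma x)%N &
           forall j, (j < fingraph.order sigma x)%N -> lab (iter j sigma x) = (j < k)%N]),
      (forall x, (lab x == lab ((sigma^-1)%g x))
                   != (lab (alpha x) == lab ((sigma^-1)%g (alpha x)))),
      (forall x, bounded x -> exists2 j, (j < 4)%N &
         [seq lab (alpha (iter (j + k) phi x)) | k <- iota 0 4]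
           = [:: false; false; true; true]) &
      (* G3, outer face: clockwise from s0 the labels are 0,0,1,1 *)
      (forall x, fconnect phi outer x -> vert (alpha x) = s0 ->
         [seq lab (alpha (iter k (phi^-1)%g x)) | k <- iota 0 4]
           = [:: false; false; true; true]) ].

(* colour of the edge of x: the common label at the endpoint where they coincide *)
Definition ecolor (x : D) : bool :=
  if lab x == lab ((sigma^-1)%g x) then lab x else lab (alpha x).

Definition Tedge (l : bool) (u v : V) : bool :=
  [exists x, [&& vert x == u, vert (alpha x) == v & ecolor x == l]].

(* x is an edge of T_l oriented from vert x towards vert (alpha x) *)
Definition out_dart (l : bool) (x : D) : bool :=
  (lab (alpha x) == lab ((sigma^-1)%g (alpha x))) && (ecolor x == l).

Definition pdart (l : bool) (v : V) : option D :=
  [pick x | (vert x == v) && out_dart l x].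

Fixpoint tpath (l : bool) (s : V) (k : nat) (v : V) : seq D :=
  match k with
  | 0 => [::]
  | k'.+1 => if v == s then [::] else
             if pdart l v is Some x then x :: tpath l s k' (vert (alpha x))
             else [::]
  end.

Definition sink (l : bool) : V := if l then s1 else s0.

Definition Ppath (l : bool) (v : V) : seq D := tpath l (sink l) #|V| v.

Definition Wpath (v : V) : seq D :=
  [seq alpha x | x <- rev (Ppath false v)] ++ Ppath true v.

Definition inW (v : V) (x : D) : bool := (x \in Wpath v) || (alpha x \in Wpath v).

(* adjacency of bounded faces (through darts) without crossing the path *)
Definition dual_rel (v : V) : rel D := fun x y =>
  [&& bounded x, bounded y &
      (y == phi x) || ((y == alpha x) && ~~ inW v x)].

(* darts of the bounded faces of R_1(v): faces to the right of Wpath v *)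
Definition Rdarts (v : V) : {set D} :=
  [set y | bounded y &&
     [exists w, [&& w \in Wpath v, bounded w & connect (dual_rel v) w y]]].

Definition f1 (v : V) : int :=
  if v == s0 then (#|V|%:Z - 2) else
  if v == s1 then -1 else (#|[set face_of y | y in Rdarts v]|)%:Z.

End QMap.

(* Main.v *)
Require Import Defs.
From HB Require Import structures.
From mathcomp Require Import all_boot all_order all_fingroup all_algebra.
From mathcomp Require Import zify.
Import Order.TTheory GRing.Theory Num.Theory.
Local Open Scope ring_scope.

Set Implicit Arguments.
Unset Strict Implicit.
Unset Printing Implicit Defensive.

(** In every face the two darts with white tail have different colours, and around
    every non-special vertex the colours form two intervals.  Hence there is a
    curve separating the colours that passes alternately through faces and
    non-special vertices, crossing each of them exactly once.  For a function [h]
    on faces, the jump of [h] across the outgoing edge of [u] in [T_l] is, by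
    telescoping around vertices, the sum over the [T_l]-descendants [v] of [u] of
    the (signed) variation of [h] along the curve at [v].

    Applied to the indicator of the faces on the component of the curve through the
    outer face, whose jumps all vanish, this shows by connectivity that the curve
    is a single closed curve and that [T_0] and [T_1] are trees; cutting it in the
    outer face numbers the vertices.  Applied to the indicator of the faces that
    precede [v], it shows that this set is bounded exactly by the paths [P_0(v)]
    and [P_1(v)], so that [f_1] is that numbering, and that the descendants of [u]
    in [T_l] form an interval of which [u] is an end: the upper end if [u] is black
    and [l = 0] or [u] is white and [l = 1], the lower end otherwise.  Both
    properties of [T_l] follow from these intervals. *)

(** * Rooted trees given by a parent function *)

Section RootedTree.
Variables (V : finType) (t : V -> V) (s : V).
Hypothesis ts : t s = s.

Lemma iter_root n : iter n t s = s.
Proof. by elim: n => //= n ->. Qed.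

Lemma fconnect_iterP u v : reflect (exists n, iter n t u = v) (fconnect t u v).
Proof.
apply: (iffP idP) => [uv|[n <-]]; last exact: fconnect_iter.
by exists (findex t u v); apply: iter_findex.
Qed.

(** If [u] had a period, every multiple of it would lead back to [u], whereas enough steps lead to
    [s] and stay there. *)
Lemma iter_acyclic u k : u != s -> fconnect t u s -> iter k.+1 t u != u.
Proof.
move=> us /fconnect_iterP[m um]; apply/eqP => uk.
have cyc j : iter (j * k.+1) t u = u.
  by elim: j => // j IHj; rewrite mulSn iterD IHj.
have := cyc m; rewrite mulnSr iterD um iter_root.
by move=> e; rewrite e eqxx in us.
Qed.

Lemma child_not_reached u c :
  u != s -> fconnect t u s -> t c = u -> fconnect t u c = false.
Proof.
move=> us ur tc; apply/negP => /fconnect_iterP[i ui].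
by have := iter_acyclic i us ur; rewrite /= ui tc eqxx.
Qed.

Lemma fconnect_parent v u : fconnect t v u -> fconnect t v (t u).
Proof. by move=> vu; apply: connect_trans vu (fconnect1 _ _). Qed.

Lemma sum_descendants (g : V -> int) u : u != s -> fconnect t u s ->
  \sum_(v | fconnect t v u) g v
  = g u + \sum_(c | t c == u) \sum_(v | fconnect t v c) g v.
Proof.
move=> us ur; rewrite (bigD1 u) ?connect0 //=; congr (_ + _).
(* The descendants other than [u] are grouped by the last vertex on their path before [u]. *)
rewrite (partition_big (fun v => iter (findex t v u).-1 t v)
  (fun c => t c == u)) /=; last first.
  move=> v /andP[vu nvu]; rewrite -iterS prednK ?iter_findex //.
  by rewrite lt0n findex_eq0 eq_sym // eq_sym.
apply: eq_bigr => c /eqP tc; apply: eq_bigl => v; apply/idP/idP.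
  by case/andP=> _ /eqP <-; apply: fconnect_iter.
move=> vc; have vu : fconnect t v u by rewrite -tc; apply: fconnect_parent.
have ncu := child_not_reached us ur tc.
have nvu : v != u by apply: contraFneq ncu => <-.
rewrite vu nvu /=; apply/eqP.
have fm : findex t v u = (findex t v c).+1.
  apply/eqP; rewrite eqn_leq; apply/andP; split.
    have e : iter (findex t v c).+1 t v = u by rewrite /= iter_findex.
    rewrite leqNgt; apply/negP => lt1.
    have lt2 : ((findex t v c).+1 < fingraph.order t v)%N.
      by apply: ltn_trans lt1 (findex_max vu).
    by have := findex_iter lt2; rewrite e => e2; rewrite e2 ltnn in lt1.
  rewrite ltnNge; apply/negP => le1; case/negP: (negbT ncu).
  apply/fconnect_iterP; exists (findex t v c - findex t v u)%N.
  by rewrite -{2}(iter_findex vu) -iterD subnK // iter_findex.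
by rewrite fm /= iter_findex.
Qed.

(** Induction on the number of descendants, which drops from [u] to a child because [u] itself is
    lost. *)
Lemma tree_sum (theta g : V -> int) :
  (forall u, u != s -> fconnect t u s ->
     theta u = g u + \sum_(c | t c == u) theta c) ->
  forall u, u != s -> fconnect t u s ->
     theta u = \sum_(v | fconnect t v u) g v.
Proof.
move=> rec u; have [n] := ubnP #|[set v | fconnect t v u]|.
elim: n u => // n IHn u; rewrite ltnS => cardu us ur.
rewrite rec // sum_descendants //; congr (_ + _).
apply: eq_bigr => c /eqP tc; have ncu := child_not_reached us ur tc.
have cu : fconnect t c u by rewrite -tc fconnect1.
apply: IHn; last exact: connect_trans cu ur; last first.
  by apply: contraNneq us => cs; rewrite -tc cs ts.
apply: leq_trans cardu; apply: proper_card; apply/properP; split.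
  by apply/subsetP => v; rewrite !inE => vc; apply: connect_trans cu.
by exists u; rewrite !inE ?connect0 // ncu.
Qed.

(** * Trees whose descendant sets are intervals: alternation and non-crossing *)

Variables (K : V -> int) (blk : V -> bool).
Hypothesis K_inj : injective K.
Hypothesis blk_alt : forall u, fconnect t u s -> u != s -> blk (t u) = ~~ blk u.
Hypothesis K_ext : forall u v, fconnect t u s -> fconnect t v u ->
  if blk u then K v <= K u else K u <= K v.
Hypothesis K_conv : forall u v1 v2 z, fconnect t u s -> fconnect t z s ->
  fconnect t v1 u -> fconnect t v2 u -> K v1 <= K z <= K v2 -> fconnect t z u.

Definition tree_edge u v :=
  [&& fconnect t u s, fconnect t v s &
      (u != s) && (t u == v) || (v != s) && (t v == u)].

Lemma tree_edge_sym u v : tree_edge u v = tree_edge v u.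
Proof. by rewrite /tree_edge andbCA orbC. Qed.

Lemma parent_neq u : u != s -> fconnect t u s -> t u != u.
Proof. exact: (@iter_acyclic u 0). Qed.

Lemma tree_edge_bipartite u v :
  tree_edge u v -> if blk u then ~~ blk v && (K v < K u) else blk v && (K u < K v).
Proof.
case/and3P=> ur vr /orP[] /andP[ns /eqP e].
  have := blk_alt ur ns; have := K_ext vr (v := u); have := parent_neq ns ur.
  rewrite -(inj_eq K_inj) e => d /(_ _) le b; rewrite b in le *.
  have {}le := le (_ : fconnect t u v); rewrite -e fconnect1 in le.
  have {le} := le isT; rewrite e; case: (blk u) => /= le; lia.
have := blk_alt vr ns; have := K_ext ur (v := v); have := parent_neq ns vr.
rewrite -(inj_eq K_inj) e => d /(_ _) le b; rewrite b in le *.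
have {}le := le (_ : fconnect t v u); rewrite -e fconnect1 in le.
have {le} := le isT; rewrite e; case: (blk v) => /= le; lia.
Qed.

(** Black vertices lie above all their neighbours and white ones below, so no vertex lies between
    two of its neighbours. *)
Lemma tree_alternating i j k :
  tree_edge i j -> tree_edge j k -> ~ (K i < K j < K k).
Proof.
rewrite tree_edge_sym => /tree_edge_bipartite + /tree_edge_bipartite.
by case: (blk j) => /andP[_ +] /andP[_ +]; lia.
Qed.

Lemma descendant_child v u : fconnect t v u -> v != u ->
  exists c, [/\ t c = u, c != u & fconnect t v c].
Proof.
move=> vu nvu; case E : (findex t v u) => [|m].
  by move/eqP: E; rewrite findex_eq0 (negPf nvu).
have e : t (iter m t v) = u by rewrite -iterS -E iter_findex.
exists (iter m t v); split; rewrite ?fconnect_iter //; apply/eqP => e2.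
have := findex_max vu; rewrite E => /ltnW lt.
by have := findex_iter lt; rewrite e2 E; lia.
Qed.

(* The descendants of a child c of w lie between w and c, and those of distinct
   children are disjoint intervals; hence everything between w and its child u
   descends from children of w lying between w and u. *)
Lemma between_parent_child u z z' : u != s -> fconnect t u s -> tree_edge z z' ->
  if blk u then K (t u) < K z < K u -> K (t u) <= K z' <= K u
  else K u < K z < K (t u) -> K u <= K z' <= K (t u).
Proof.
move=> us ur; set w := t u => /and3P[zr z'r ed].
have wr : fconnect t w s.
  by case/fconnect_iterP: ur => -[|n]; [move=> /= e; rewrite e eqxx in us|
     rewrite iterSr => e; apply/fconnect_iterP; exists n].
have uw : fconnect t u w by rewrite fconnect1.
have blkw : blk w = ~~ blk u by apply: blk_alt.
(* The only edge leaving the set of descendants of [c] is the one from [c] to its parent [w]. *)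
have inside c : t c = w -> c != s -> fconnect t z c -> fconnect t z' c \/ z' = w.
  move=> tc cs zc; case/orP: ed => /andP[ns /eqP e]; last first.
    by left; apply: connect_trans zc; rewrite -e fconnect1.
  have [ezc|nzc] := eqVneq z c; first by right; rewrite -e ezc.
  by left; rewrite -e; case/fconnect_iterP: zc => -[|n];
    [move=> /= /eqP; rewrite (negPf nzc)|rewrite iterSr => h; apply/fconnect_iterP; exists n].
have child : z != w -> fconnect t z w ->
    exists c, [/\ t c = w, c != s, fconnect t z c, blk c = blk u & fconnect t c s].
  move=> nzw zw; have [c [tc ncw zc]] := descendant_child zw nzw.
  have cr : fconnect t c s by apply: connect_trans wr; rewrite -tc fconnect1.
  have cs : c != s by apply: contraNneq ncw => cs; rewrite -tc cs ts.
  exists c; split=> //; have := blk_alt cr cs.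
  by rewrite tc blkw => /negb_inj.
(* If [u] were a proper descendant of its sibling [c], so would be [w], and [c] would lie on a
   cycle. *)
have unique c : t c = w -> c != s -> fconnect t c s -> fconnect t u c -> u = c.
  move=> tc cs cr /fconnect_iterP[[//|n]]; rewrite iterSr -/w -tc -iterSr => e.
  by have := iter_acyclic n cs cr; rewrite e eqxx.
case bu : (blk u) child => child /andP[lt1 lt2].
- have zw : fconnect t z w.
    by apply: (K_conv wr zr (connect0 _ _) uw); rewrite !ltW.
  have nzw : z != w by apply: contraTneq lt1 => ->; rewrite ltxx.
  have [c [tc cs zc bc cr]] := child nzw zw.
  (* Otherwise [u] lies between [z] and [c], both descendants of [c], and convexity makes [u] one as
     well. *)
  have lec : K c <= K u.
    rewrite leNgt; apply/negP => lt; suff e : u = c by rewrite e ltxx in lt.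
    apply: unique => //.
    by apply: (K_conv cr ur zc (connect0 _ _)); rewrite !ltW.
  have cw : fconnect t c w by rewrite -tc fconnect1.
  case: (inside _ tc cs zc) => [z'c|->]; last by rewrite lexx (ltW (lt_trans lt1 lt2)).
  have := K_ext cr z'c; have := K_ext wr (connect_trans z'c cw).
  by rewrite bc blkw bu /= => -> /le_trans ->.
have zw : fconnect t z w.
  by apply: (K_conv wr zr uw (connect0 _ _)); rewrite !ltW.
have nzw : z != w by apply: contraTneq lt2 => ->; rewrite ltxx.
have [c [tc cs zc bc cr]] := child nzw zw.
have lec : K u <= K c.
  rewrite leNgt; apply/negP => lt; suff e : u = c by rewrite e ltxx in lt.
  apply: unique => //.
  by apply: (K_conv cr ur (connect0 _ _) zc); rewrite !ltW.
have cw : fconnect t c w by rewrite -tc fconnect1.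
case: (inside _ tc cs zc) => [z'c|->]; last by rewrite lexx (ltW (lt_trans lt1 lt2)).
have := K_ext cr z'c; have := K_ext wr (connect_trans z'c cw).
by rewrite bc blkw bu /= => -> /(le_trans lec) ->.
Qed.

(** Of [a] and [c] one is the parent of the other; [b] lies strictly between them, which confines
    [d] to the same range. *)
Lemma tree_noncrossing a b c d : tree_edge a c -> tree_edge b d ->
  ~ [&& K a < K b, K b < K c & K c < K d].
Proof.
move=> ac bd; have /and3P[ar cr /orP[] /andP[ns /eqP e]] := ac.
  have := between_parent_child ns ar bd; have := tree_edge_bipartite ac.
  by rewrite e; case: (blk a) => /andP[_]; lia.
have := between_parent_child ns cr bd; have := tree_edge_bipartite ac.
by have := blk_alt cr ns; rewrite e; case: (blk c) => -> /andP[_]; lia.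
Qed.

End RootedTree.

(** * Faces of the quadrangulation and the outer face *)

Section StrongLabeling.
Variables (D V : finType) (alpha sigma : {perm D}) (vert : D -> V).
Variables (black : V -> bool) (outer : D) (s0 s1 : V) (lab : D -> bool).
Hypothesis quadQ : quadrangulation alpha sigma vert black.
Hypothesis labQ : strong_labeling alpha sigma vert black outer s0 s1 lab.

Local Notation phi := (phi alpha sigma).
Local Notation col := (ecolor alpha sigma lab).
Local Notation bounded := (bounded alpha sigma outer).
Local Notation sV := ((sigma^-1)%g : {perm D}).

Lemma alphaK x : alpha (alpha x) = x.
Proof. by case: quadQ => [[[_ ->]]]. Qed.

Lemma phiE x : phi x = sigma (alpha x).
Proof. exact: permM. Qed.

Lemma phi_alpha x : phi (alpha x) = sigma x.
Proof. by rewrite phiE alphaK. Qed.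

Lemma vert_eq x y : (vert x == vert y) = fconnect sigma x y.
Proof. by case: quadQ => [[_ ->]]. Qed.

Lemma vert_sigma x : vert (sigma x) = vert x.
Proof. by apply/esym/eqP; rewrite vert_eq fconnect1. Qed.

Lemma vert_sigmaV x : vert (sV x) = vert x.
Proof. by rewrite -{2}(permKV sigma x) vert_sigma. Qed.

Lemma vert_phi x : vert (phi x) = vert (alpha x).
Proof. by rewrite phiE vert_sigma. Qed.

Lemma phi4 x : phi (phi (phi (phi x))) = x.
Proof. by case: quadQ => [_ _ /(_ x)[]]. Qed.

Lemma phiV x : (phi^-1)%g x = phi (phi (phi x)).
Proof. by apply: (@perm_inj _ phi); rewrite permKV phi4. Qed.

Lemma sigmaV_phi x : sV x = alpha (phi (phi (phi x))).
Proof. by apply: (@perm_inj _ sigma); rewrite permKV -phiE phi4. Qed.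

Lemma sigmaV_phiS x : sV (phi x) = alpha x.
Proof. by rewrite sigmaV_phi phi4. Qed.

Lemma black_alpha x : black (vert (alpha x)) = ~~ black (vert x).
Proof. by case: quadQ => _ _ _ _ /(_ x); case: black; case: black. Qed.

Lemma black_phi x : black (vert (phi x)) = ~~ black (vert x).
Proof. by rewrite vert_phi black_alpha. Qed.

Lemma faceP x y : reflect [\/ y = x, y = phi x, y = phi (phi x) | y = phi (phi (phi x))]
  (fconnect phi x y).
Proof.
apply: (iffP idP) => [/fconnect_iterP[n <-]|[] ->].
- elim: n => [|n [] /= ->]; [constructor 1|constructor 2|constructor 3|constructor 4|constructor 1] => //.
  by rewrite phi4.
- exact: connect0.
- exact: (fconnect_iter phi 1).
- exact: (fconnect_iter phi 2).
- exact: (fconnect_iter phi 3).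
Qed.

Lemma face_sym x y : fconnect phi x y = fconnect phi y x.
Proof. by apply: fconnect_sym; apply: perm_inj. Qed.

(** The outer dart ending at [s0], from which the outer labels are read. [odartP] shows that the
    default value does not occur. *)
Definition odart : D :=
  odflt outer [pick x | fconnect phi outer x && (vert (alpha x) == s0)].

Lemma odartP : fconnect phi outer odart /\ vert (alpha odart) = s0.
Proof.
rewrite /odart; case: pickP => [x /andP[? /eqP] //|no] /=.
case: labQ => -[_ _ /existsP[x] + _ _] _ _ _ _; rewrite inE => /andP[ox /eqP vx].
have /negP[] := negbT (no ((phi^-1)%g x)); rewrite -vert_phi permKV vx eqxx andbT.
by apply: connect_trans ox _; rewrite face_sym -{2}(permKV phi x) fconnect1.
Qed.

Lemma unboundedE x : ~~ bounded x = fconnect phi odart x.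
Proof.
have [o _] := odartP; rewrite negbK; apply/idP/idP => h.
  by apply: connect_trans h; rewrite face_sym.
by apply: connect_trans h.
Qed.

(** * Labels around faces and colours of edges *)

Lemma outer_labels : [/\ lab (alpha odart) = false, lab (alpha (phi odart)) = true,
  lab (alpha (phi (phi odart))) = true & lab (alpha (phi (phi (phi odart)))) = false].
Proof.
have [o v] := odartP; case: labQ => _ _ _ _ /(_ _ o v) /=.
by rewrite !phiV !phi4 => -[-> -> -> ->].
Qed.

(** Two places apart in the cyclic word 0,0,1,1 the letters differ, in either direction of
    reading. *)
Lemma lab_phi2 x : lab (alpha (phi (phi x))) = ~~ lab (alpha x).
Proof.
case bx : (bounded x); last first.
  have [l0 l1 l2 l3] := outer_labels.
  by move/negbT: bx; rewrite unboundedE => /faceP[] ->; rewrite ?phi4 ?l0 ?l1 ?l2 ?l3.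
case: labQ => _ _ _ /(_ x bx) [] [|[|[|[|//]]]] _ /=;
  by rewrite ?phi4 => -[e0 e1 e2 e3]; rewrite ?e0 ?e1 ?e2 ?e3.
Qed.

Lemma lab_edge x : (lab x == lab (sV x)) != (lab (alpha x) == lab (sV (alpha x))).
Proof. by case: labQ. Qed.

(* Along phi, whose faces lie to the right, the labels of a face read
   white 1, black 1, white 0, black 0. *)
Definition good x := (lab (sV x) == lab (alpha x)) == ~~ black (vert x).

Lemma good_alpha x : good (alpha x) = good x.
Proof.
rewrite /good alphaK black_alpha; have := lab_edge x.
by case: (lab x); case: (lab (sV x)); case: (lab (alpha x));
  case: (lab (sV (alpha x))); case: (black _).
Qed.

Lemma good_phi x : good (phi x) = good x.
Proof.
rewrite /good sigmaV_phiS black_phi sigmaV_phi.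
rewrite lab_phi2.
by case: (lab (alpha x)); case: (lab (alpha (phi x))); case: (black _).
Qed.

Lemma map_connected (P : pred D) : P odart ->
  (forall x, P x -> P (alpha x)) -> (forall x, P x -> P (phi x)) -> forall x, P x.
Proof.
move=> P0 Pa Pp x; case: quadQ => [[_ _ _ /(_ odart x) /connectP[p pp ->] _] _ _ _ _].
elim: p odart P0 pp => //= y p IHp z Pz /andP[zy]; apply: IHp.
by case/orP: zy => /eqP ->; [apply: Pa|rewrite -phi_alpha; apply/Pp/Pa].
Qed.

Lemma black_s0 : black s0. Proof. by case: labQ => -[_ /andP[]]. Qed.
Lemma black_s1 : black s1. Proof. by case: labQ => -[_ /andP[]]. Qed.
Lemma s01 : s0 != s1. Proof. by case: labQ => -[]. Qed.

(** The property passes across an edge by (G2) and along a face because opposite angles differ; it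
    holds at the outer corner of [s0], and the map is connected. *)
Lemma all_good x : good x.
Proof.
apply: map_connected => [|{}x|{}x]; rewrite ?good_alpha ?good_phi //.
have [_ v] := odartP; have [l0 _ _ l3] := outer_labels.
by rewrite /good sigmaV_phi l0 l3 eqxx -[odart]alphaK black_alpha v black_s0.
Qed.

Lemma col_alpha x : col (alpha x) = col x.
Proof.
rewrite /ecolor alphaK; have := lab_edge x.
by case: (lab x == _); case: (lab (alpha x) == _).
Qed.

(** By [all_good] the two angles to the left of an edge directed from black to white have equal
    labels; at whichever end the labels coincide, they equal this one. *)
Lemma colE x : col x = lab (if black (vert x) then x else sV x).
Proof.
case bx : (black (vert x)).
  rewrite -col_alpha; have := all_good (alpha x); rewrite /good alphaK black_alpha bx.
  by rewrite /ecolor alphaK => /eqP /eqP e; case: ifP => // /eqP ->.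
have := all_good x; rewrite /good bx /ecolor => /eqP /eqP <-.
by case: ifP => // /eqP.
Qed.

Lemma col_phi2 x : ~~ black (vert x) -> col (phi (phi x)) = ~~ col x.
Proof.
move=> bx; rewrite !colE !black_phi negbK (negPf bx) !sigmaV_phiS.
by rewrite sigmaV_phi lab_phi2 negbK.
Qed.

(** An edge leaves the end where its labels differ. Through [colE] this becomes a colour change next
    to the edge, on its clockwise side at a black tail and on its counterclockwise side at a white
    one. *)
Lemma out_dartE l x : out_dart alpha sigma lab l x =
  (col x == l) && (col x != col (if black (vert x) then sV x else sigma x)).
Proof.
rewrite /out_dart andbC; congr andb.
have -> : (lab (alpha x) == lab (sV (alpha x))) = (lab x != lab (sV x)).
  by have := lab_edge x; case: (lab x == _); case: (lab (alpha x) == _).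
rewrite !colE; case bx : (black (vert x)).
  by rewrite vert_sigmaV bx.
by rewrite vert_sigma bx permK eq_sym.
Qed.

Lemma col_s0 x : vert x = s0 -> col x = false.
Proof.
move=> vx; rewrite colE vx black_s0; case: labQ => -[_ _ _ _ /(_ x)[+ _]] _ _ _ _.
exact.
Qed.

Lemma col_s1 x : vert x = s1 -> col x = true.
Proof.
move=> vx; rewrite colE vx black_s1; case: labQ => -[_ _ _ _ /(_ x)[_ +]] _ _ _ _.
exact.
Qed.

(** * Colours around ordinary vertices and on the outer face *)

Definition ordinary u := (u != s0) && (u != s1).

Local Notation ordr := (fingraph.order sigma).

Lemma col_interval u : ordinary u -> exists y k, [/\ vert y = u, (0 < k < ordr y)%N &
  forall j, (j < ordr y)%N -> col (iter j sigma y) = (j < k)%N].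
Proof.
case/andP=> u0 u1; case: labQ => _ /(_ u u0 u1) [x [k [vx kx lx]]] _ _ _.
have vi j y : vert (iter j sigma y) = vert y.
  by elim: j => //= j <-; rewrite vert_sigma.
case bu : (black u).
  by exists x, k; split=> // j /lx <-; rewrite colE vi vx bu.
(* At a white vertex [colE] reads the label one place back, hence the start at [sigma x]. *)
have ex : ordr (sigma x) = ordr x.
  by apply: eq_card => y; rewrite !inE -!vert_eq vert_sigma.
exists (sigma x), k; split; rewrite ?vert_sigma ?ex // => j /lx <-.
by rewrite colE vi vert_sigma vx bu -iterSr /= permK.
Qed.

Lemma white_odart : ~~ black (vert odart).
Proof. by have [_ v] := odartP; rewrite -black_alpha v black_s0. Qed.

Lemma vert_odart3 : vert (phi (phi (phi odart))) = s1.
Proof.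
have [o v] := odartP; have bo := white_odart.
case: labQ => -[_ _ _ /existsP[x] + _] _ _ _ _; rewrite inE => /andP[ox /eqP vx].
have : fconnect phi odart x by apply: connect_trans ox; rewrite face_sym.
case/faceP=> e; rewrite -?e // in vx *; exfalso.
- by move: bo; rewrite -e vx black_s1.
- by have := s01; rewrite -vx e vert_phi v eqxx.
- by have := black_phi (phi odart); rewrite -e vx black_s1 black_phi (negPf bo).
Qed.

Lemma outer_cols : [/\ col odart = false, col (phi odart) = false,
  col (phi (phi odart)) = true & col (phi (phi (phi odart))) = true].
Proof.
have [o v] := odartP; have c1 : col (phi odart) = false by rewrite col_s0 // vert_phi.
have c0 : col odart = false by rewrite -col_alpha col_s0.
by rewrite (col_phi2 white_odart) c0 c1 (col_s1 vert_odart3).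
Qed.

(** * Colour changes at the corners of faces and vertices *)

Definition first (l : bool) x := (col x == l) && (col (sV x) != l).

(** Turning clockwise at the tail of [x] amounts to stepping back along the face on its right, so a
    colour starts around a vertex exactly where it starts along a face. *)
Lemma firstE l x : first l x = (col x == l) && (col (phi (phi (phi x))) != l).
Proof. by rewrite /first sigmaV_phi col_alpha. Qed.

Lemma face_cols x : col (phi (phi x)) = ~~ col x \/
  col (phi (phi (phi x))) = ~~ col (phi x).
Proof.
case bx : (black (vert x)); last by left; rewrite col_phi2 ?bx.
by right; rewrite col_phi2 // black_phi bx.
Qed.

Definition firstf l x : D :=
  if first l x then x else if first l (phi x) then phi x else
  if first l (phi (phi x)) then phi (phi x) else phi (phi (phi x)).

Lemma first_firstf l x : first l (firstf l x).
Proof.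
rewrite /firstf; case: ifP => // n0; case: ifP => // n1; case: ifP => // n2.
move: n0 n1 n2; rewrite !firstE !phi4; have := face_cols x.
by case: l; case: (col x); case: (col (phi x)); case: (col (phi (phi x)));
  case: (col (phi (phi (phi x)))) => // -[].
Qed.

Lemma firstf_face l x : fconnect phi x (firstf l x).
Proof.
apply/faceP; rewrite /firstf; case: ifP => _; first by constructor 1.
case: ifP => _; first by constructor 2.
by case: ifP => _; [constructor 3|constructor 4].
Qed.

(** Two opposite edges of different colours leave room for only one change towards each colour. *)
Lemma first_face_inj l x y : first l x -> first l y -> fconnect phi x y -> y = x.
Proof.
rewrite !firstE => fx + /faceP xy; case: xy => -> //; rewrite !phi4; move: fx;
  have := face_cols x;
  by case: l; case: (col x); case: (col (phi x)); case: (col (phi (phi x)));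
    case: (col (phi (phi (phi x)))) => // -[].
Qed.

Lemma firstf_eq l x y : first l y -> fconnect phi x y -> firstf l x = y.
Proof.
move=> fy xy; apply: first_face_inj fy (first_firstf _ _) _.
by apply: connect_trans (firstf_face l x); rewrite face_sym.
Qed.

Lemma firstf_id l x : first l x -> firstf l x = x.
Proof. by move=> fx; apply: firstf_eq. Qed.

Lemma eq_firstf l x y : fconnect phi x y -> firstf l y = firstf l x.
Proof.
move=> xy; apply: firstf_eq; first exact: first_firstf.
by apply: connect_trans (firstf_face _ _); rewrite face_sym.
Qed.

Lemma firstf_phi l x : firstf l (phi x) = firstf l x.
Proof. by apply: eq_firstf; apply: fconnect1. Qed.

Lemma firstf_firstf l m x : firstf l (firstf m x) = firstf l x.
Proof. by apply: eq_firstf; apply: firstf_face. Qed.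

Lemma first_ordinary l x : first l x -> ordinary (vert x).
Proof.
rewrite /first => /andP[/eqP cx]; apply: contraR; rewrite negb_and !negbK.
by case/orP => /eqP v; rewrite -cx;
  [rewrite !col_s0 ?vert_sigmaV|rewrite !col_s1 ?vert_sigmaV].
Qed.

(** The default [odart] has a white tail, which is how [vert_outd_special] detects special
    vertices. *)
Definition firstv l u : D := odflt odart [pick y | (vert y == u) && first l y].

Lemma firstv_interval u : ordinary u -> exists k,
  [/\ forall l, vert (firstv l u) = u,
      forall l x, vert x = u -> first l x = (x == firstv l u),
      (0 < k < ordr (firstv true u))%N,
      firstv false u = iter k sigma (firstv true u) &
      forall j, (j < ordr (firstv true u))%N ->
        col (iter j sigma (firstv true u)) = (j < k)%N].
Proof.
move=> ou; have [y [k [vy ky cy]]] := col_interval ou.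
have e0 : sV y = iter (ordr y).-1 sigma y.
  apply: (@perm_inj _ sigma); rewrite permKV -iterS prednK ?fingraph.order_gt0 // iter_order //.
  exact: perm_inj.
have fy x : vert x = u -> first true x = (x == y) /\ first false x = (x == iter k sigma y).
  move/eqP; rewrite -vy eq_sym vert_eq => yx.
  have jlt := findex_max yx; rewrite -(iter_findex yx).
  move: (findex _ _ _) jlt => j jlt; rewrite /first cy //.
  have uj i m : (i < ordr y)%N -> (m < ordr y)%N -> (iter i sigma y == iter m sigma y) = (i == m).
    move=> il ml; apply/eqP/eqP => [e|->] //.
    by rewrite -(findex_iter il) e findex_iter.
  have -> : (iter j sigma y == y) = (j == 0)%N by rewrite -(uj j 0%N) //; lia.
  rewrite uj //; last lia.
  case: j jlt => [|j] jlt.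
    by rewrite e0 cy; lia.
  rewrite [iter j.+1 _ _]/= permK cy; lia.
have fv l z : vert z = u -> (forall x, vert x = u -> first l x = (x == z)) -> firstv l u = z.
  move=> vz fz; rewrite /firstv; case: pickP => [x /andP[/eqP vx]|/(_ z)] /=.
    by rewrite fz // => /eqP.
  by rewrite vz fz ?eqxx.
have vi j : vert (iter j sigma y) = u by elim: j => //= j <-; rewrite vert_sigma.
have e1 : firstv true u = y by apply: fv => // x /fy[].
have e2 : firstv false u = iter k sigma y by apply: fv => // x /fy[].
by exists k; rewrite e1; split=> //; case; rewrite ?e1 ?e2 // => x /fy[].
Qed.

Lemma vert_firstv l u : ordinary u -> vert (firstv l u) = u.
Proof. by case/firstv_interval => k []. Qed.

Lemma first_firstv l u : ordinary u -> first l (firstv l u).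
Proof. by case/firstv_interval => k [vu -> //]; rewrite eqxx. Qed.

Lemma firstv_vert l x : first l x -> firstv l (vert x) = x.
Proof.
move=> fx; have [k [_ /(_ l x (erefl _)) + _ _ _]] := firstv_interval (first_ordinary fx).
by rewrite fx => /esym/eqP.
Qed.

(** * Parent functions and reachability of the sinks *)

Definition outd l u : D := if black u then firstv l u else sV (firstv (~~ l) u).

Definition par l u : V := if ordinary u then vert (alpha (outd l u)) else u.

Lemma out_dart_first l x : out_dart alpha sigma lab l x =
  if black (vert x) then first l x else first (~~ l) (sigma x).
Proof.
rewrite out_dartE /first permK; case: (black _); case: l;
  by case: (col x); case: (col _).
Qed.

Lemma vert_outd l u : ordinary u -> vert (outd l u) = u.
Proof. by rewrite /outd => ou; case: ifP => _; rewrite ?vert_sigmaV vert_firstv. Qed.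

Lemma out_dart_outd l u : ordinary u -> out_dart alpha sigma lab l (outd l u).
Proof.
move=> ou; rewrite out_dart_first vert_outd // /outd.
by case: (black u); rewrite ?permKV first_firstv.
Qed.

Lemma out_dart_ordinary l x : out_dart alpha sigma lab l x -> ordinary (vert x).
Proof.
rewrite out_dart_first; case: ifP => _ /first_ordinary //.
by rewrite vert_sigma.
Qed.

Lemma outd_vert l x : out_dart alpha sigma lab l x -> outd l (vert x) = x.
Proof.
rewrite out_dart_first /outd; case: (black _) => fx; first exact: firstv_vert.
by rewrite -[vert x]vert_sigma firstv_vert // permK.
Qed.

Lemma out_dart_col l x : out_dart alpha sigma lab l x -> col x = l.
Proof. by case/andP=> _ /eqP. Qed.

Lemma out_dart_alpha l x : col x = l ->
  out_dart alpha sigma lab l (alpha x) = ~~ out_dart alpha sigma lab l x.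
Proof.
move=> cx; rewrite /out_dart alphaK col_alpha cx eqxx !andbT.
by have := lab_edge x; case: (lab x == _); case: (lab (alpha x) == _).
Qed.

Lemma vert_outd_special l u : vert (outd l u) = u -> ordinary u.
Proof.
move=> vu; apply/negPn/negP => nou; have bu : black u.
  by move: nou; rewrite negb_and !negbK => /orP[] /eqP ->;
    rewrite ?black_s0 ?black_s1.
move: vu; rewrite /outd bu /firstv; case: pickP => [x /andP[/eqP vx fx]|_] /=.
  by case/negP: nou; rewrite -vx (first_ordinary fx).
by move=> e; have := white_odart; rewrite e bu.
Qed.

Lemma par_special l u : ~~ ordinary u -> par l u = u.
Proof. by rewrite /par => /negPf ->. Qed.

Local Notation snk := (sink s0 s1).

Lemma par_sink l : par l (snk l) = snk l.
Proof. by apply: par_special; rewrite /ordinary negb_and !negbK; case: l; rewrite eqxx ?orbT. Qed.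

Lemma par_out l x : out_dart alpha sigma lab l x -> par l (vert x) = vert (alpha x).
Proof. by move=> ox; rewrite /par (out_dart_ordinary ox) (outd_vert ox). Qed.

(** Until [curve_total] is proved [par l] may have cycles; this marks the vertices whose path does
    end at the sink. *)
Definition reach l u := fconnect (par l) u (snk l).

Lemma reach_par l u : reach l (par l u) = reach l u.
Proof.
apply/idP/idP => [|/fconnect_iterP[[|n]]]; first by apply: connect_trans; apply: fconnect1.
  by move=> /= ->; rewrite par_sink /reach connect0.
by rewrite iterSr => e; apply/fconnect_iterP; exists n.
Qed.

Lemma reach_alpha l x : col x = l -> reach l (vert (alpha x)) = reach l (vert x).
Proof.
move=> cx; case ox : (out_dart alpha sigma lab l x); first by rewrite -(par_out ox) reach_par.
have := out_dart_alpha cx; rewrite ox => /par_out; rewrite alphaK => <-.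
by rewrite reach_par.
Qed.

Lemma reach_phi l x : col x = l -> reach l (vert (phi x)) = reach l (vert x).
Proof. by move=> cx; rewrite vert_phi reach_alpha. Qed.

Lemma reach_ordinary l u : reach l u -> u != snk l -> ordinary u.
Proof.
move=> ru us; apply/negPn/negP => /(par_special l) pu.
case/fconnect_iterP: ru => n; suff -> : iter n (par l) u = u by move/eqP; rewrite (negPf us).
by elim: n => //= n ->.
Qed.

(** The edges of colour [l] in a face are consecutive, so they link [x] to the corner where the
    colour starts. *)
Lemma reach_firstf l x : col x = l -> reach l (vert (firstf l x)) = reach l (vert x).
Proof.
move=> cx; have := firstf_face l x; rewrite face_sym => yx.
have := first_firstf l x; move: (firstf l x) yx => y yx fy.
have := fy; rewrite firstE => /andP[/eqP cy cy3].
have /faceP[e|e|e|e] := yx; [by rewrite e|by rewrite e reach_phi| |]; last first.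
  by move: cy3; rewrite -e cx eqxx.
have [cy1|cy1] := eqVneq (col (phi y)) l; first by rewrite e !reach_phi.
suff fx : first l x by rewrite (first_face_inj fy fx yx).
by rewrite firstE e phi4 -e cx eqxx.
Qed.

(** The run of colour [l] along the face ends at the corner where the other colour starts. *)
Lemma reach_firstfN l x : first l x -> reach l (vert (firstf (~~ l) x)) = reach l (vert x).
Proof.
have fN y : fconnect phi x y -> col y != l -> col (phi (phi (phi y))) = l -> firstf (~~ l) x = y.
  move=> xy cy cy3; apply: firstf_eq => //; rewrite firstE cy3.
  by move: cy; case: (l); case: (col y).
rewrite firstE => /andP[/eqP cx cx3].
have r1 := reach_phi cx; have [c1|c1] := eqVneq (col (phi x)) l; last first.
  by rewrite (fN (phi x)) ?phi4 // fconnect1.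
have r2 := reach_phi c1; have [c2|c2] := eqVneq (col (phi (phi x))) l; last first.
  by rewrite (fN (phi (phi x))) ?phi4 ?r2 // (fconnect_iter phi 2).
have r3 := reach_phi c2.
by rewrite (fN (phi (phi (phi x)))) ?phi4 ?r3 ?r2 // (fconnect_iter phi 3).
Qed.

(** * The curve separating the colours *)

(* The vertices met in this order by the closed curve that separates the two
   colours: it leaves u through the angle before the first edge of colour 0 and
   crosses that face to the vertex whose first edge of colour 1 bounds it. *)
Definition nxt u : V := if ordinary u then vert (firstf true (firstv false u)) else u.

Lemma nxt_first x : first false x -> nxt (vert x) = vert (firstf true x).
Proof. by move=> fx; rewrite /nxt (first_ordinary fx) firstv_vert. Qed.

Lemma nxt_firstf x : nxt (vert (firstf false x)) = vert (firstf true x).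
Proof. by rewrite nxt_first ?first_firstf // firstf_firstf. Qed.

Lemma nxt_ordinary u : ordinary (nxt u) = ordinary u.
Proof.
rewrite {1}/nxt; case ou : (ordinary u) => //.
exact: first_ordinary (first_firstf _ _).
Qed.

(** A crossing can be read backwards, because each face has a single corner where colour 0
    starts. *)
Lemma nxt_inj : injective nxt.
Proof.
move=> u v e; have := nxt_ordinary u; rewrite e nxt_ordinary => ov.
move: e; rewrite /nxt -ov; case: ifP => // ou e.
rewrite ou in ov; have fu := first_firstv false (esym ov); have fv := first_firstv false ou.
rewrite -(vert_firstv false (esym ov)) -(vert_firstv false ou); congr vert.
have e1 : firstf true (firstv false u) = firstf true (firstv false v).
  by rewrite -(firstv_vert (first_firstf true _)) e firstv_vert ?first_firstf.
apply: (first_face_inj fv fu); apply: connect_trans (firstf_face true _) _.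
by rewrite -e1 face_sym firstf_face.
Qed.

Definition wp : V := vert (phi (phi odart)).

Lemma first_odart : first false odart.
Proof. by rewrite firstE; case: outer_cols => -> _ _ ->. Qed.

Lemma first_odart2 : first true (phi (phi odart)).
Proof. by rewrite firstE !phi4; case: outer_cols => _ -> -> _. Qed.

Lemma nxt_last : nxt (vert odart) = wp.
Proof.
rewrite nxt_first ?first_odart // /wp; congr vert; apply: firstf_eq first_odart2 _.
exact: (fconnect_iter phi 2).
Qed.

(** Outer edges of colours 0 and 1 join [wp] to [s0] and [s1]; in each crossed face, a run of either
    colour joins the vertices where the curve enters and leaves it. *)
Lemma reach_curve u : fconnect nxt wp u -> [/\ ordinary u, reach false u & reach true u].
Proof.
case/fconnect_iterP=> n <-; elim: n => [|n /= [ou ru0 ru1]].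
  have [c0 c1 c2 c3] := outer_cols; split; first exact: (first_ordinary first_odart2).
    by rewrite /wp reach_phi // vert_phi; have [_ ->] := odartP; apply: connect0.
  by rewrite /wp -reach_phi // vert_odart3; apply: connect0.
move: (iter n nxt wp) ou ru0 ru1 => u' ou ru0 ru1.
have ff := first_firstv false ou; rewrite nxt_ordinary ou /nxt ou; split=> //.
  by rewrite (reach_firstfN ff) vert_firstv.
rewrite -(reach_firstfN (first_firstf true _)) /= firstf_firstf firstf_id //.
by rewrite vert_firstv.
Qed.

(** * Jumps of a face function across tree edges *)

Lemma sum_color (h : D -> int) l u : ordinary u ->
  (forall x, vert x = u -> h (alpha x) = h (sigma x)) ->
  \sum_(x | (vert x == u) && (col x == l)) (h x - h (alpha x))
  = h (firstv l u) - h (firstv (~~ l) u).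
Proof.
move=> ou hu; have [k [vu _ /andP[k0 kN] fk cy]] := firstv_interval ou.
set y := firstv true u in fk kN cy; have vy : vert y = u by exact: vu.
have vi j : vert (iter j sigma y) = u by elim: j => //= j <-; rewrite vert_sigma.
have yN : iter (ordr y) sigma y = y by apply: iter_order; apply: perm_inj.
rewrite big_mkcondr /= (eq_bigl (fun x => x \in fingraph.orbit sigma y)); last first.
  by move=> x; rewrite -fconnect_orbit -vert_eq vy eq_sym.
rewrite -big_uniq ?orbit_uniq //= (big_nth y) size_orbit.
pose F j := if (j < k)%N == l then h (iter j sigma y) - h (iter j.+1 sigma y) else 0.
rewrite (eq_big_nat _ _ (F2 := F)); last first.
  move=> j /andP[_ jN]; rewrite nth_traject // cy // /F; case: ifP => // _.
  by rewrite hu.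
have kNl := ltnW kN; rewrite (big_cat_nat (n := k)) //=.
(* By [hu] the value to the left of a dart is the value to the right of the next one, so the terms
   cancel along a run. *)
have tele a b : (a <= b)%N ->
    \sum_(a <= j < b) (h (iter j sigma y) - h (iter j.+1 sigma y))
    = h (iter a sigma y) - h (iter b sigma y).
  move=> ab; apply: oppr_inj; rewrite -sumrN opprB.
  by rewrite -(telescope_sumr (fun j => h (iter j sigma y)) ab);
    apply: eq_bigr => j _; rewrite opprB.
have [lo hi] : (\sum_(0 <= j < k) F j = if l then h y - h (iter k sigma y) else 0) /\
    (\sum_(k <= j < ordr y) F j = if l then 0 else h (iter k sigma y) - h y).
  split; case: l @F => F.
  - rewrite -(tele 0%N k) //; apply: eq_big_nat => j /andP[_ jk].
    by rewrite /F jk.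
  - by rewrite big_nat_cond big1 // => j /andP[/andP[_ jk] _]; rewrite /F jk.
  - by rewrite big_nat_cond big1 // => j /andP[/andP[kj _] _]; rewrite /F ltnNge kj.
  (* The run of colour 0 ends after a full turn, back at [y]. *)
  rewrite -{3}yN -tele //; apply: eq_big_nat => j /andP[kj _].
  by rewrite /F ltnNge kj.
by rewrite lo hi; case: (l); rewrite ?addr0 ?add0r fk.
Qed.

Definition jump (h : D -> int) l u : int := h (outd l u) - h (alpha (outd l u)).

(** Of the edges of colour [l] at [u], one leaves for the parent and the others arrive from the
    children, with sides exchanged; [sum_color] evaluates the total. *)
Lemma jump_rec (h : D -> int) l u : ordinary u ->
  (forall x, vert x = u -> h (alpha x) = h (sigma x)) ->
  jump h l u = h (firstv l u) - h (firstv (~~ l) u) + \sum_(c | par l c == u) jump h l c.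
Proof.
move=> ou hu; rewrite -sum_color //.
have oo := out_dart_outd l ou; have co := out_dart_col oo.
rewrite (bigD1 (outd l u)) /=; last by rewrite vert_outd // co !eqxx.
rewrite -[LHS]addr0 -[RHS]addrA; congr (_ + _).
rewrite (reindex_onto (fun c => alpha (outd l c)) (fun x => vert (alpha x))) /=; last first.
  move=> x /andP[/andP[/eqP vx /eqP cx] nx]; rewrite outd_vert ?alphaK //.
  rewrite out_dart_alpha //; apply: contra nx => ox.
  by rewrite -(outd_vert ox) vx.
rewrite [X in X + _](eq_big (fun c => par l c == u) (fun c => - jump h l c)).
- by rewrite sumrN addNr.
- move=> c; rewrite alphaK col_alpha; case oc : (ordinary c); last first.
    rewrite par_special ?oc //; transitivity false.
      apply/negP => /andP[_ /eqP] /vert_outd_special; by rewrite oc.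
    by apply/esym/negP => /eqP e; rewrite e ou in oc.
  rewrite vert_outd // eqxx andbT (out_dart_col (out_dart_outd l oc)) eqxx andbT /par oc.
  case: eqP => //= e; apply/eqP => e2; move: oo; rewrite -e2 out_dart_alpha ?out_dart_outd //.
  exact: out_dart_col (out_dart_outd l oc).
- by move=> c _; rewrite /jump alphaK opprB.
Qed.

Lemma jump_sum (h : D -> int) (g : V -> int) l :
  (forall x, ordinary (vert x) -> h (alpha x) = h (sigma x)) ->
  (forall u, ordinary u -> h (firstv l u) - h (firstv (~~ l) u) = g u) ->
  forall u, reach l u -> u != snk l ->
  jump h l u = \sum_(v | fconnect (par l) v u) g v.
Proof.
move=> hh hg u ru us; apply: (tree_sum (par_sink l)) us ru => {}u us ru.
have ou := reach_ordinary ru us; rewrite -hg //; apply: jump_rec => // x vx.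
by apply: hh; rewrite vx.
Qed.

Lemma curve_total u : ordinary u -> fconnect nxt wp u.
Proof.
pose P x := fconnect nxt wp (vert (firstf false x)).
have Pphi x : P (phi x) = P x by rewrite /P firstf_phi.
suff PP : forall x, P x.
  by move=> ou; have := PP (firstv false u); rewrite /P firstf_id ?first_firstv ?vert_firstv.
have curve_nxt v : fconnect nxt wp (nxt v) = fconnect nxt wp v.
  by rewrite -(same_fconnect1_r nxt_inj).
pose h x : int := (P x)%:Z.
(* The faces before and after a vertex lie on the same component of the curve, so [h] has no
   variation there. *)
have hj l v : reach l v -> v != snk l -> jump h l v = 0.
  move=> rv vs; rewrite (jump_sum (g := fun=> 0) (l := l) _ _ rv vs) ?big1 //.
    by move=> x _; rewrite /h -phi_alpha Pphi.
  move=> w ow; suff e m : h (firstv m w) = (fconnect nxt wp w)%:Z by rewrite !e subrr.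
  rewrite /h /P; case: m; last by rewrite firstf_id ?first_firstv ?vert_firstv.
  by rewrite -curve_nxt nxt_firstf firstf_id ?first_firstv ?vert_firstv.
apply: map_connected => [|x Px|x]; last by rewrite Pphi.
  by rewrite /P firstf_id ?first_odart // -curve_nxt nxt_last connect0.
have [c cx] : exists c, col x = c by eexists.
(* [jump_sum] needs access to the sink: within its face, [x] is linked in its own colour to a vertex
   on the component of [wp]. *)
have rx : reach c (vert x).
  rewrite -(reach_firstf cx); case: c {cx}; last by case: (reach_curve Px).
  by rewrite -nxt_firstf; move: Px; rewrite /P -curve_nxt => /reach_curve[].
have rax : reach c (vert (alpha x)) by rewrite reach_alpha.
have ord_sink v : ordinary v -> v != snk c by case/andP; case: (c).
have Ph y : P y = (h y == 1) by rewrite /h; case: (P y).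
case ox : (out_dart alpha sigma lab c x).
  have := hj c _ rx (ord_sink _ (out_dart_ordinary ox)).
  by move/eqP; rewrite /jump (outd_vert ox) subr_eq0 Ph => /eqP <-; rewrite -Ph.
have oax : out_dart alpha sigma lab c (alpha x) by rewrite out_dart_alpha // ox.
have := hj c _ rax (ord_sink _ (out_dart_ordinary oax)).
by move/eqP; rewrite /jump (outd_vert oax) alphaK subr_eq0 Ph => /eqP ->; rewrite -Ph.
Qed.

Lemma ordinary_reach l u : ordinary u -> reach l u.
Proof. by move/curve_total/reach_curve => []; case: l. Qed.

(** * Positions along the curve *)

Definition pos u : nat := findex nxt wp u.

Lemma iter_pos u : ordinary u -> iter (pos u) nxt wp = u.
Proof. by move/curve_total/iter_findex. Qed.

Lemma pos_inj u v : ordinary u -> ordinary v -> pos u = pos v -> u = v.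
Proof. by move=> ou ov e; rewrite -(iter_pos ou) e iter_pos. Qed.

Lemma ordinary_wp : ordinary wp.
Proof. exact: first_ordinary first_odart2. Qed.

Lemma pos_wp : pos wp = 0%N.
Proof. exact: findex0. Qed.

Lemma iter_nxt_ordinary n : ordinary (iter n nxt wp).
Proof. by elim: n => [|n IHn]; rewrite ?ordinary_wp //= nxt_ordinary. Qed.

(** At the end of the cycle [nxt u] is [wp], whose only predecessor is [vert odart]. *)
Lemma pos_nxt u : ordinary u -> u != vert odart -> pos (nxt u) = (pos u).+1.
Proof.
move=> ou uw; have cu := curve_total ou; have := findex_max cu.
rewrite leq_eqVlt => /orP[/eqP e|lt]; last first.
  by rewrite /pos -{1}(iter_findex cu) -iterS findex_iter.
case/eqP: uw; apply: nxt_inj; rewrite nxt_last -{1}(iter_findex cu) -iterS e.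
by rewrite iter_order //; apply: nxt_inj.
Qed.

(* Index, along the curve, of the bounded face to the right of x.  The curve is
   cut open in the outer face, whose darts on either side of the cut get the two
   extreme values. *)
Definition idx x : int :=
  if (x == phi odart) || (x == phi (phi odart)) then -1
  else (pos (vert (firstf false x)))%:Z.

Lemma not_ordinary_s0 : ordinary s0 = false.
Proof. by rewrite /ordinary eqxx. Qed.

Lemma not_ordinary_s1 : ordinary s1 = false.
Proof. by rewrite /ordinary eqxx andbF. Qed.

Lemma vert_odart1 : vert (phi odart) = s0.
Proof. by rewrite vert_phi; case: odartP. Qed.

(** Along the outer face [idx] changes only at the corners of [s0] and [s1]. *)
Lemma idx_corner x : ordinary (vert x) -> idx (alpha x) = idx (sigma x).
Proof.
rewrite -[sigma x]phi_alpha -[vert x]vert_sigma -[sigma x]phi_alpha.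
move: (alpha x) => y oy; rewrite /idx firstf_phi !(inj_eq perm_inj).
case: (eqVneq y (phi odart)) => [->|n1]; first by rewrite orbT.
case: (eqVneq y odart) => [e|n2].
  by move: oy; rewrite e vert_odart1 not_ordinary_s0.
case: (eqVneq y (phi (phi odart))) => [e|n3 //].
by move: oy; rewrite e vert_odart3 not_ordinary_s1.
Qed.

Lemma idx_exit u : ordinary u -> idx (firstv false u) = (pos u)%:Z.
Proof.
move=> ou; have fu := first_firstv false ou; rewrite /idx firstf_id // vert_firstv //.
case: eqP => [e|_ /=].
  by have := ou; rewrite -(vert_firstv false ou) e vert_odart1 not_ordinary_s0.
case: eqP => // e; move: fu; rewrite e => /andP[].
by case: outer_cols => _ _ ->.
Qed.

(** The face before [u] is the face after its predecessor; before [wp] it is the part of the outer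
    face with value [-1], in accordance with [pos_wp]. *)
Lemma idx_entry u : ordinary u -> idx (firstv true u) = (pos u)%:Z - 1.
Proof.
move=> ou; have fu := first_firstv true ou; rewrite /idx.
case: eqP => [e|_ /=].
  by move: fu; rewrite e => /andP[]; case: outer_cols => _ ->.
case: eqP => [e|ne].
  have -> : u = wp by rewrite -(vert_firstv true ou) e.
  by rewrite pos_wp.
set u' := vert _; have nu : nxt u' = u by rewrite nxt_firstf firstf_id // vert_firstv.
have pu : pos u = (pos u').+1; last by rewrite pu intS addrC addKr.
rewrite -[in LHS]nu pos_nxt -?(nxt_ordinary u') ?nu //.
apply/eqP => e; apply: ne; have := nxt_last; rewrite -e nu => ->.
exact: firstv_vert first_odart2.
Qed.

Lemma unbounded_odart : [/\ bounded odart = false, bounded (phi odart) = false,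
  bounded (phi (phi odart)) = false & bounded (phi (phi (phi odart))) = false].
Proof.
split; apply: negbTE; rewrite unboundedE; [exact: connect0|exact: fconnect1| |].
  exact: (fconnect_iter phi 2).
exact: (fconnect_iter phi 3).
Qed.

Lemma idx_bounded x : bounded x -> idx x = (pos (vert (firstf false x)))%:Z.
Proof.
rewrite /idx; have [_ b1 b2 _] := unbounded_odart.
by case: eqP => [->|_]; rewrite ?b1 //; case: eqP => [->|_]; rewrite ?b2.
Qed.

Lemma bounded_phi x : bounded (phi x) = bounded x.
Proof. by rewrite /Defs.bounded -(same_fconnect1_r (@perm_inj _ phi)). Qed.

Lemma idx_phi x : bounded x -> idx (phi x) = idx x.
Proof. by move=> bx; rewrite !idx_bounded ?bounded_phi // firstf_phi. Qed.

(** * Faces preceding a vertex, and intervals of descendants *)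

Definition side v x : int := (idx x < (pos v)%:Z)%R%:Z.

(** Along the curve [side v] varies only at [v], where it drops from 1 to 0, so the sum in
    [jump_sum] has at most one nonzero term. *)
Lemma side_jump l u v : ordinary u -> ordinary v ->
  jump (side v) l u = if l then (fconnect (par l) v u)%:Z else - (fconnect (par l) v u)%:Z.
Proof.
move=> ou ov; pose e : int := if l then 1 else -1.
rewrite (jump_sum (g := fun w => if w == v then e else 0)); last first.
- by have [/= n0 n1] := andP ou; case: (l).
- exact: ordinary_reach.
- move=> w ow; rewrite /side.
  have -> : (w == v) = (pos w == pos v).
    by apply/eqP/eqP => [->|/(pos_inj ow ov)].
  by case: (l) @e => e; rewrite /= idx_exit // idx_entry // /e; clear; case: ltngtP; lia.
- by move=> x ox; rewrite /side idx_corner.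
rewrite -big_mkcondr /=; case: (boolP (fconnect _ v u)) => [cv|ncv].
  rewrite (big_pred1 v); first by case: (l) @e.
  by move=> w; apply/andP/eqP => [[_ /eqP]|->].
rewrite big_pred0; first by case: (l).
by move=> w; apply/andP => -[cw /eqP ew]; rewrite -ew cw in ncv.
Qed.

(** The outgoing edge of [u] has on one side the face just before or just after [u]; [r] is the
    index on its other side. By [side_jump] the descendants are the vertices whose positions
    separate the two. *)
Lemma descendants_interval l u : ordinary u -> exists r : int,
  forall v, ordinary v -> fconnect (par l) v u =
  if black u != l then r < (pos v)%:Z <= (pos u)%:Z else (pos u)%:Z <= (pos v)%:Z <= r.
Proof.
move=> ou; have sJ := side_jump l ou.
have oV m : idx (alpha (sV (firstv m u))) = idx (firstv m u).
  by rewrite idx_corner ?permKV // vert_sigmaV vert_firstv.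
exists (idx (if black u then alpha (outd l u) else outd l u)) => v ov.
move: (sJ v ov); rewrite /jump /side /outd; case: (black u).
  by case: l {sJ}; rewrite ?idx_exit ?idx_entry //=; case: (fconnect _ _ _); clear; lia.
by case: l {sJ}; rewrite oV ?idx_exit ?idx_entry //=; case: (fconnect _ _ _); clear; lia.
Qed.

(** * The two paths of a vertex and the region they bound *)

Local Notation tpath := (tpath alpha sigma vert lab).
Local Notation Ppath := (Ppath alpha sigma vert s0 s1 lab).
Local Notation Wpath := (Wpath alpha sigma vert s0 s1 lab).
Local Notation inW := (inW alpha sigma vert s0 s1 lab).
Local Notation dual_rel := (dual_rel alpha sigma vert outer s0 s1 lab).
Local Notation Rdarts := (Rdarts alpha sigma vert outer s0 s1 lab).
Local Notation outdart := (out_dart alpha sigma lab).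

Lemma pdartE l u : pdart alpha sigma vert lab l u =
  if ordinary u then Some (outd l u) else None.
Proof.
rewrite /pdart; case: pickP => [x /andP[/eqP <- ox]|no].
  by rewrite (out_dart_ordinary ox) (outd_vert ox).
case: ifP => // ou; have := no (outd l u).
by rewrite vert_outd // eqxx out_dart_outd.
Qed.

Lemma mem_tpath l k v x : reflect
  (exists2 j, (j < k)%N & ordinary (iter j (par l) v) /\ x = outd l (iter j (par l) v))
  (x \in tpath l (snk l) k v).
Proof.
elim: k v => [|k IHk] v; first by apply: (iffP idP) => // -[].
have stop : ~~ ordinary v -> reflect (exists2 j, (j < k.+1)%N &
    ordinary (iter j (par l) v) /\ x = outd l (iter j (par l) v)) (x \in [::]).
  move=> nov; apply: (iffP idP) => // -[j _ [oj _]]; case/negP: nov.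
  move: oj; suff: iter j (par l) v = v \/ ordinary v by case=> [->|].
  case ov : (ordinary v); [by right|left].
  by elim: j => //= j ->; rewrite par_special ?ov.
rewrite /=; case: eqP => [vs|_].
  by apply: stop; rewrite vs; case: (l); rewrite ?not_ordinary_s0 ?not_ordinary_s1.
rewrite pdartE; case ov: (ordinary v); last by apply: stop; rewrite ov.
have -> : vert (alpha (outd l v)) = par l v by rewrite /par ov.
rewrite inE; apply: (iffP orP) => [[/eqP ->|/IHk[j jk]]|[[|j] jk]].
- by exists 0%N.
- by rewrite -iterSr => h; exists j.+1.
- by case=> _ ->; left.
- by rewrite iterSr => h; right; apply/IHk; exists j.
Qed.

Lemma mem_Ppath l v x :
  (x \in Ppath l v) = outdart l x && fconnect (par l) v (vert x).
Proof.
apply/mem_tpath/andP => [[j _ [oj ->]]|[ox vx]].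
  by rewrite out_dart_outd // vert_outd // fconnect_iter.
(* The fuel [#|V|] suffices, since the vertices before the first visit are distinct. *)
exists (findex (par l) v (vert x)).
  by apply: leq_trans (findex_max vx) (max_card _).
by rewrite iter_findex // (out_dart_ordinary ox) (outd_vert ox).
Qed.

Lemma mem_Wpath v x : (x \in Wpath v) = (alpha x \in Ppath false v) || (x \in Ppath true v).
Proof.
rewrite mem_cat; congr orb; rewrite -{1}[x]alphaK.
by rewrite (mem_map (@perm_inj _ alpha)) mem_rev.
Qed.

Lemma inW_alpha v x : inW v (alpha x) = inW v x.
Proof. by rewrite /Defs.inW alphaK orbC. Qed.

Lemma inW_out l v x : outdart l x -> inW v x = fconnect (par l) v (vert x).
Proof.
move=> ox; have cx := out_dart_col ox; have oax := out_dart_alpha cx.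
rewrite /Defs.inW !mem_Wpath !mem_Ppath alphaK.
have no m y : col y = ~~ m -> outdart m y = false.
  by move=> cy; apply/negP => /out_dart_col; rewrite cy; case: (m).
case: l cx ox oax => cx ox; rewrite ox => oax; rewrite oax.
  by rewrite !(no false) ?col_alpha ?cx //= orbF.
by rewrite !(no true) ?col_alpha ?cx //= orbF.
Qed.

Lemma inW_col v x : inW v x -> fconnect (par (col x)) v (vert x).
Proof.
case ox : (outdart (col x) x); first by rewrite (inW_out _ ox).
have oax : outdart (col x) (alpha x) by rewrite out_dart_alpha // ox.
rewrite -inW_alpha (inW_out _ oax) => /fconnect_parent.
by rewrite (par_out oax) alphaK.
Qed.

Lemma side_inW v x : ordinary v -> ~~ inW v x -> side v (alpha x) = side v x.
Proof.
move=> ov; case ox : (outdart (col x) x).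
  rewrite (inW_out _ ox) => nW; have := side_jump (col x) (out_dart_ordinary ox) ov.
  by rewrite /jump (outd_vert ox) (negPf nW) if_same => /eqP; rewrite subr_eq0 => /eqP.
have oax : outdart (col x) (alpha x) by rewrite out_dart_alpha // ox.
rewrite -inW_alpha (inW_out _ oax) => nW.
have := side_jump (col x) (out_dart_ordinary oax) ov.
by rewrite /jump (outd_vert oax) alphaK (negPf nW) if_same => /eqP; rewrite subr_eq0 => /eqP.
Qed.

(** [Wpath v] runs from [s0] through [v] to [s1]; reversing the darts of colour 0 matches the
    opposite signs in [side_jump]. *)
Lemma side_Wpath v x : ordinary v -> x \in Wpath v -> idx x < (pos v)%:Z.
Proof.
move=> ov; rewrite mem_Wpath !mem_Ppath => /orP[] /andP[ox vx].
  have := side_jump false (out_dart_ordinary ox) ov.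
  by rewrite /jump (outd_vert ox) vx alphaK /side; clear; lia.
have := side_jump true (out_dart_ordinary ox) ov.
by rewrite /jump (outd_vert ox) vx /side; clear; lia.
Qed.

(** A walk through faces that avoids the paths keeps [side v] constant. *)
Lemma Rdarts_side v y : ordinary v -> y \in Rdarts v -> bounded y /\ idx y < (pos v)%:Z.
Proof.
move=> ov; rewrite inE => /andP[_ /existsP[w /and3P[wW bw /connectP[p pp ->]]]].
have := side_Wpath ov wW.
elim: p w bw pp {wW} => [|z p IHp] w bw //= /andP[/and3P[_ bz wz] pp] iw.
apply: IHp => //; case/orP: wz => [/eqP ->|/andP[/eqP -> nW]].
  by rewrite idx_phi.
by have := side_inW ov nW; rewrite /side iw; case: ltP.
Qed.

Lemma dual_face v x y : bounded x -> fconnect phi x y -> connect (dual_rel v) x y.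
Proof.
move=> bx /fconnect_iterP[n <-]; elim: n => [|n IHn]; first exact: connect0.
apply: connect_trans IHn (connect1 _).
have bn : bounded (iter n phi x) by elim: n => //= n; rewrite bounded_phi.
by rewrite /= /Defs.dual_rel bounded_phi bn eqxx.
Qed.

Lemma dual_sym v x y : connect (dual_rel v) x y -> connect (dual_rel v) y x.
Proof.
case/connectP=> p pp ->; elim: p x pp => [|z p IHp] x /=; first by rewrite connect0.
case/andP=> /and3P[bx bz xz] /IHp h; apply: connect_trans h _.
case/orP: xz => [/eqP ->|/andP[/eqP ez nW]].
  by apply: dual_face; rewrite ?bounded_phi // face_sym fconnect1.
by apply: connect1; rewrite /Defs.dual_rel bx bz ez inW_alpha alphaK nW eqxx orbT.
Qed.

Lemma first_unbounded x : ~~ bounded x -> ordinary (vert x) -> first (col x) x.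
Proof.
have [c0 c1 c2 c3] := outer_cols.
rewrite unboundedE => /faceP[] ->; rewrite ?vert_odart1 ?vert_odart3 ?not_ordinary_s0
  ?not_ordinary_s1 // => _; rewrite ?c0 ?c2; [exact: first_odart|exact: first_odart2].
Qed.

Lemma firstv_run l u : ordinary u -> exists m,
  iter m sigma (firstv l u) = firstv (~~ l) u /\
  forall j, (j < m)%N -> col (iter j sigma (firstv l u)) = l.
Proof.
move=> ou; have [k [_ _ /andP[k0 kN] fk cy]] := firstv_interval ou.
case: l.
  by exists k; rewrite fk; split=> // j jk; rewrite cy ?jk // (ltn_trans jk).
exists (ordr (firstv true u) - k)%N; rewrite fk -iterD subnK ?(ltnW kN) //.
split=> [|j jk]; first by rewrite iter_order //; apply: perm_inj.
have jN : (j + k < ordr (firstv true u))%N by rewrite addnC -ltn_subRL.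
by rewrite -iterD cy // ltnNge leq_addl.
Qed.

(** Rotate about [u] through its run of colour [l]. The faces inside the run are bounded, as the
    outer face meets an ordinary vertex only where a colour starts. *)
Lemma dual_around v l u : ordinary u ->
  (forall x, vert x = u -> col x = l -> ~~ inW v x) ->
  bounded (firstv l u) -> bounded (firstv (~~ l) u) ->
  connect (dual_rel v) (firstv l u) (firstv (~~ l) u).
Proof.
move=> ou nW b0 bm; have [m [em cm]] := firstv_run l ou.
have vi j : vert (iter j sigma (firstv l u)) = u.
  by elim: j => [|j IHj]; rewrite ?vert_firstv //= vert_sigma.
have bj j : (j <= m)%N -> bounded (iter j sigma (firstv l u)).
  case: j => // j; rewrite leq_eqVlt => /orP[/eqP ->|jm]; first by rewrite em.
  case: (boolP (bounded _)) => // /first_unbounded; rewrite vi => /(_ ou).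
  by rewrite /first /= permK (cm _ jm) cm ?eqxx ?andbF // ltnW.
rewrite -em; elim: {-2}m (leqnn m) => [|j IHj] jm; first exact: connect0.
apply: connect_trans (IHj (ltnW jm)) _; set x := iter j _ _.
have bx : bounded x by apply/bj/ltnW.
have bax : bounded (alpha x) by rewrite -bounded_phi phi_alpha; apply: (bj j.+1).
apply: (@connect_trans _ _ (alpha x)).
  apply: connect1; rewrite /Defs.dual_rel bx bax eqxx nW ?orbT //; first exact: vi.
  exact: cm.
by apply: dual_face => //=; rewrite -phi_alpha fconnect1.
Qed.

(** In the two trees [u] is at opposite ends of its interval of descendants, so these meet in [u]
    alone. *)
Lemma paths_disjoint u v : ordinary u -> ordinary v ->
  fconnect (par false) v u -> fconnect (par true) v u -> u = v.
Proof.
move=> ou ov; have [r0 ->] := descendants_interval false ou; last by [].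
have [r1 ->] := descendants_interval true ou; last by [].
move=> h0 h1; apply: pos_inj => //; move: h0 h1; case: (black u) => /=; clear; lia.
Qed.

(** At most one of the two paths visits [u], so one can turn around [u] through the edges of the
    other colour. *)
Lemma dual_through v u : ordinary u -> ordinary v -> u != v ->
  bounded (firstv false u) -> bounded (firstv true u) ->
  connect (dual_rel v) (firstv true u) (firstv false u).
Proof.
move=> ou ov uv b0 b1; case c0 : (fconnect (par false) v u); last first.
  apply: dual_sym; apply: (dual_around (l := false)) => // x vx cx.
  by apply: contraFN c0 => /inW_col; rewrite vx cx.
apply: (dual_around (l := true)) => // x vx cx; apply: contra uv => /inW_col.
by rewrite vx cx => c1; rewrite (paths_disjoint ou ov c0 c1).
Qed.

Lemma pos_iter i v : ordinary v -> (i <= pos v)%N -> pos (iter i nxt wp) = i.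
Proof.
move=> ov iv; apply: findex_iter; apply: leq_ltn_trans iv _.
exact: findex_max (curve_total ov).
Qed.

(** The curve enters the outer face only from [vert odart], whose successor [wp] has position 0. *)
Lemma bounded_exit i v : ordinary v -> (i < pos v)%N ->
  bounded (firstv false (iter i nxt wp)).
Proof.
move=> ov iv; have oi := iter_nxt_ordinary i; case: (boolP (bounded _)) => //.
rewrite unboundedE => /(first_face_inj first_odart (first_firstv false oi)) e.
have := pos_iter ov iv; rewrite /= -(vert_firstv false oi) e nxt_last pos_wp.
by [].
Qed.

Lemma nxt_face u : ordinary u -> fconnect phi (firstv false u) (firstv true (nxt u)).
Proof.
move=> ou; rewrite /nxt ou firstv_vert ?first_firstf //; exact: firstf_face.
Qed.

Lemma same_bounded x y : fconnect phi x y -> bounded x -> bounded y.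
Proof. by move=> xy bx; apply: contra bx => oy; apply: connect_trans oy _; rewrite face_sym. Qed.

(** Going back along the curve from [v], consecutive faces are joined around the vertex between
    them. *)
Lemma dual_chain v i : ordinary v -> (i < pos v)%N ->
  connect (dual_rel v) (firstv true v) (firstv false (iter i nxt wp)).
Proof.
move=> ov iv; have [d ed] : exists d, pos v = (i + d).+1 by exists (pos v - i.+1)%N; lia.
elim: d i iv ed => [|d IHd] i iv ed;
  have bi := bounded_exit ov iv; have oi := iter_nxt_ordinary i;
  have bn := same_bounded (nxt_face oi) bi.
  have e : nxt (iter i nxt wp) = v by rewrite -iterS -(iter_pos ov) ed addn0.
  by apply/dual_sym/dual_face => //; move: (nxt_face oi); rewrite e.
have iv1 : (i.+1 < pos v)%N by rewrite ed addnS ltnS ltnS leq_addr.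
apply: connect_trans (IHd i.+1 iv1 _) _; first by rewrite ed addnS.
apply: dual_sym; apply: connect_trans (dual_face v bi (nxt_face oi)) _.
apply: dual_through; rewrite ?nxt_ordinary //; last exact: (bounded_exit ov iv1).
by apply: contraTneq iv1 => e; rewrite -e -iterS (pos_iter ov iv) ltnn.
Qed.

Lemma RdartsE v y : ordinary v ->
  (y \in Rdarts v) = bounded y && (idx y < (pos v)%:Z).
Proof.
move=> ov; apply/idP/andP => [/(Rdarts_side ov) //|[bdy]].
rewrite idx_bounded // ltz_nat => lt; rewrite inE bdy /=.
have ff := first_firstf false y; have oy := first_ordinary ff.
have cy : connect (dual_rel v) (firstv true v) y.
  apply: connect_trans (dual_chain ov lt) _; rewrite iter_pos // firstv_vert //.
  by apply/dual_sym/dual_face => //; apply: firstf_face.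
have bv : bounded (firstv true v).
  have v0 : (0 < pos v)%N by apply: leq_ltn_trans lt.
  have e : nxt (iter (pos v).-1 nxt wp) = v by rewrite -iterS prednK // iter_pos.
  have oi := iter_nxt_ordinary (pos v).-1; have := nxt_face oi; rewrite e.
  by move/same_bounded; apply; apply: (bounded_exit ov); rewrite ltn_predL.
(* The face just before [v] is to the right of the outgoing edge of colour 1 if [v] is black, and of
   the reversed outgoing edge of colour 0 if [v] is white. *)
case bl : (black v).
  have eo : outd true v = firstv true v by rewrite /outd bl.
  apply/existsP; exists (firstv true v); rewrite bv cy andbT mem_Wpath !mem_Ppath.
  by rewrite -eo out_dart_outd // vert_outd // connect0 orbT.
have eo : outd false v = sV (firstv true v) by rewrite /outd bl.
have ph : phi (alpha (outd false v)) = firstv true v by rewrite phi_alpha eo permKV.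
have ba : bounded (alpha (outd false v)) by rewrite -bounded_phi ph.
apply/existsP; exists (alpha (outd false v)); rewrite ba mem_Wpath !mem_Ppath alphaK.
rewrite out_dart_outd // vert_outd // connect0 /=; apply: connect_trans cy.
by apply: dual_face => //; rewrite -ph fconnect1.
Qed.

(** * The function [f1] as position on the curve *)

Local Notation F1 := (f1 alpha sigma vert outer s0 s1 lab).

Lemma same_face_of x y : (face_of alpha sigma x == face_of alpha sigma y) = fconnect phi x y.
Proof.
apply/eqP/idP => [/setP/(_ y)|xy]; first by rewrite !inE connect0.
by apply/setP => z; rewrite !inE; apply: same_connect xy z; apply: face_sym.
Qed.

(** The bounded faces preceding [v] are those through which the curve leaves the first [pos v]
    vertices. *)
Lemma f1_ordinary v : ordinary v -> F1 v = (pos v)%:Z.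
Proof.
move=> ov; rewrite /f1; case/andP: (ov) => /negPf -> /negPf ->; congr Posz.
pose fc (i : 'I_(pos v)) := face_of alpha sigma (firstv false (iter i nxt wp)).
transitivity #|[set fc i | i : 'I_(pos v)]|; last first.
  rewrite card_imset ?card_ord // => i j /eqP; rewrite same_face_of => ij.
  have [oi oj] := (iter_nxt_ordinary i, iter_nxt_ordinary j).
  have e := first_face_inj (first_firstv false oi) (first_firstv false oj) ij.
  apply: val_inj; rewrite /= -(pos_iter ov (ltnW (ltn_ord i))).
  by rewrite -(vert_firstv false oi) -e vert_firstv // (pos_iter ov (ltnW (ltn_ord j))).
apply: eq_card => A; apply/imsetP/imsetP => [[y]|[i _ ->]].
  rewrite RdartsE // => /andP[bdy]; rewrite idx_bounded // ltz_nat => lt ->.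
  exists (Ordinal lt) => //; apply/eqP; rewrite same_face_of /= iter_pos; last first.
    exact: first_ordinary (first_firstf _ _).
  by rewrite firstv_vert ?first_firstf // firstf_face.
exists (firstv false (iter i nxt wp)) => //; rewrite RdartsE //.
have oi := iter_nxt_ordinary i; rewrite idx_exit // (pos_iter ov (ltnW (ltn_ord i))).
by rewrite (bounded_exit ov (ltn_ord i)) ltz_nat ltn_ord.
Qed.

Lemma card_ordinary : (#|[pred u | ordinary u]| + 2)%N = #|V|.
Proof.
rewrite -(cardsC [set s0; s1]) cards2 s01 addnC; congr addn.
by apply: eq_card => u; rewrite !inE negb_or.
Qed.

Lemma pos_lt u : ordinary u -> (pos u + 2 < #|V|)%N.
Proof.
move=> ou; rewrite -card_ordinary ltn_add2r.
apply: leq_trans (findex_max (curve_total ou)) _; apply: subset_leq_card.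
by apply/subsetP => w; rewrite !inE => /reach_curve[].
Qed.

Lemma f1_s0 : F1 s0 = #|V|%:Z - 2.
Proof. by rewrite /f1 eqxx. Qed.

Lemma f1_s1 : F1 s1 = -1.
Proof. by rewrite /f1 eq_sym (negPf s01) eqxx. Qed.

Variant vertex_spec u : V -> bool -> Type :=
  | VertexS0 : vertex_spec u s0 false
  | VertexS1 : vertex_spec u s1 false
  | VertexOrd of ordinary u : vertex_spec u u true.

Lemma vertexP u : vertex_spec u u (ordinary u).
Proof.
have [-> | n0] := eqVneq u s0; first by rewrite not_ordinary_s0; constructor.
have [-> | n1] := eqVneq u s1; first by rewrite not_ordinary_s1; constructor.
have ou : ordinary u by rewrite /ordinary n0.
by rewrite ou; constructor.
Qed.

Lemma f1_inj : injective F1.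
Proof.
move=> u v; case: (vertexP u) => [||ou]; case: (vertexP v) => [||ov] //;
  rewrite ?f1_s0 ?f1_s1 ?f1_ordinary //.
- by have := pos_lt ordinary_wp; clear; lia.
- by have := pos_lt ov; clear; lia.
- by have := pos_lt ordinary_wp; clear; lia.
- by have := pos_lt ou; clear; lia.
- by case; apply: pos_inj.
Qed.

(** * Order properties of the two trees *)

(* Changing the sign for colour 1 makes black vertices larger than their
   neighbours in both trees. *)
Definition key (l : bool) u : int := if l then - F1 u else F1 u.

Lemma key_inj l : injective (key l).
Proof. by case: l => u v => [/oppr_inj/f1_inj|/f1_inj]. Qed.

(** [F1] is largest at [s0] and smallest at [s1], and [key true] reverses the order. *)
Lemma key_sink l u : reach l u -> key l u <= key l (snk l).
Proof.
move=> ru; rewrite /key; have := pos_lt ordinary_wp.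
have [->|us] := eqVneq u (snk l); first by rewrite lexx.
have ou := reach_ordinary ru us; have := pos_lt ou.
by rewrite f1_ordinary //; case: (l); rewrite /= ?f1_s0 ?f1_s1; move: #|V|; clear; lia.
Qed.

Lemma descendant_ordinary l u v : ordinary u -> fconnect (par l) v u -> ordinary v.
Proof.
move=> ou /fconnect_iterP[n]; case ov : (ordinary v) => //.
suff -> : iter n (par l) v = v by move=> e; rewrite -e ov in ou.
by elim: n => //= n ->; rewrite par_special ?ov.
Qed.

Lemma key_ext l u v : reach l u -> fconnect (par l) v u ->
  if black u then key l v <= key l u else key l u <= key l v.
Proof.
move=> ru vu; have [e|us] := eqVneq u (snk l).
  have -> : black u by rewrite e; case: (l); rewrite ?black_s0 ?black_s1.
  by rewrite e key_sink //; apply: connect_trans ru.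
have ou := reach_ordinary ru us; have ov := descendant_ordinary ou vu.
have [r /(_ v ov)] := descendants_interval l ou; rewrite vu /key !f1_ordinary //.
by case: (l); case: (black u) => /=; clear; lia.
Qed.

Lemma key_conv l u v1 v2 z : reach l u -> reach l z ->
  fconnect (par l) v1 u -> fconnect (par l) v2 u ->
  key l v1 <= key l z <= key l v2 -> fconnect (par l) z u.
Proof.
move=> ru rz vu1 vu2; have [-> //|us] := eqVneq u (snk l).
have ou := reach_ordinary ru us.
have [ov1 ov2] := (descendant_ordinary ou vu1, descendant_ordinary ou vu2).
have [r dr] := descendants_interval l ou; move: vu1 vu2; rewrite (dr v1) // (dr v2) //.
(* The sink is strictly above the ordinary vertex [v2], so it cannot be [z]. *)
have [->|zs] := eqVneq z (snk l).
  have := pos_lt ov2; rewrite /key (f1_ordinary ov2) => lt _ _ /andP[_]; move: lt.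
  by case: (l); rewrite /= ?f1_s0 ?f1_s1; move: #|V|; clear; lia.
have oz := reach_ordinary rz zs; rewrite dr // /key !f1_ordinary //.
by case: (l); case: (black u) => /=; clear; lia.
Qed.

Lemma par_black l u : reach l u -> u != snk l -> black (par l u) = ~~ black u.
Proof.
move=> ru us; have ou := reach_ordinary ru us.
by rewrite /par ou black_alpha vert_outd.
Qed.

Lemma Tedge_tree l a b : Tedge alpha sigma vert lab l a b ->
  tree_edge (par l) (snk l) a b.
Proof.
case/existsP=> x /and3P[/eqP <- /eqP <- /eqP cx]; rewrite /tree_edge.
have ord_sink w : ordinary w -> w != snk l by case/andP; case: (l).
case ox : (outdart l x).
  have ov := out_dart_ordinary ox; have rv := ordinary_reach l ov.
  rewrite -/(reach l _) rv -/(reach l _) reach_alpha // rv /=.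
  by rewrite ord_sink // (par_out ox) eqxx.
have oax : outdart l (alpha x) by rewrite out_dart_alpha // ox.
have ov := out_dart_ordinary oax; have rv := ordinary_reach l ov.
rewrite -/(reach l _) -reach_alpha // rv -/(reach l _) rv /=.
by rewrite (ord_sink _ ov) (par_out oax) alphaK eqxx orbT.
Qed.

Lemma key_noncrossing l a b c d :
  Tedge alpha sigma vert lab l a c -> Tedge alpha sigma vert lab l b d ->
  ~ [&& key l a < key l b, key l b < key l c & key l c < key l d].
Proof.
move=> /Tedge_tree ac /Tedge_tree bd.
exact: (tree_noncrossing (par_sink l) (@key_inj l) (@par_black l) (@key_ext l) (@key_conv l)).
Qed.

Lemma key_alternating l i j k :
  Tedge alpha sigma vert lab l i j -> Tedge alpha sigma vert lab l j k ->
  ~ (key l i < key l j < key l k).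
Proof.
move=> /Tedge_tree ij /Tedge_tree jk.
exact: (tree_alternating (par_sink l) (@key_inj l) (@par_black l) (@key_ext l)).
Qed.

Lemma Tedge_sym l a b : Tedge alpha sigma vert lab l a b -> Tedge alpha sigma vert lab l b a.
Proof.
case/existsP=> x /and3P[vx vax cx]; apply/existsP; exists (alpha x).
by rewrite vax alphaK vx col_alpha.
Qed.

End StrongLabeling.

Theorem theorem20 (D V : finType) (alpha sigma : {perm D}) (vert : D -> V)
    (black : V -> bool) (outer : D) (s0 s1 : V) (lab : D -> bool) :
  quadrangulation alpha sigma vert black ->
  strong_labeling alpha sigma vert black outer s0 s1 lab ->
  let F1 := f1 alpha sigma vert outer s0 s1 lab in
  let T := Tedge alpha sigma vert lab in
  injective F1 /\
  (forall (l : bool) (a b c d : V), T l a c -> T l b d ->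
     ~ [&& F1 a < F1 b, F1 b < F1 c & F1 c < F1 d]) /\
  (forall (l : bool) (i j k : V), T l i j -> T l j k ->
     ~ (F1 i < F1 j < F1 k)).
Proof.
move=> quadQ labQ F1 T; split; first exact: f1_inj quadQ labQ.
split=> [[] a b c d ac bd|[] i j k ij jk].
(* For colour 1 the key reverses the order, so the two edges are swapped and their ends
   exchanged. *)
- have := key_noncrossing quadQ labQ (Tedge_sym quadQ labQ bd) (Tedge_sym quadQ labQ ac).
  by rewrite /key !ltrN2 => n /and3P[ab bc cd]; apply: n; rewrite ab bc cd.
- exact: (key_noncrossing quadQ labQ (l := false)).
- have := key_alternating quadQ labQ (Tedge_sym quadQ labQ jk) (Tedge_sym quadQ labQ ij).
  by rewrite /key !ltrN2 => n /andP[h1 h2]; apply: n; rewrite h1 h2.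
- exact: (key_alternating quadQ labQ (l := false)).
Qed.
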